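(* Let $(\mathcal{C},\otimes,1)$ be a monoidal category which has equalizers and in which every object is flat. Let $\psi:C\to D$ be a morphism of coalgebras in $\mathcal{C}$. Then the following assertions are equivalent: (i) $\psi$ is a split-mono as a $D$-bicomodule morphism in $\mathcal{C}$, i.e. there exists a $D$-bicomodule morphism $\chi:D\to C$ in $\mathcal{C}$ such that $\chi\circ\psi=\mathrm{Id}_C$; (ii) $\psi$ is a monomorphism and there is a $D$-bicomodule morphism $\chi:D\to C$ in $\mathcal{C}$ such that $\varepsilon_C\circ\chi\circ\psi=\varepsilon_C$. If one of these equivalent conditions holds, then (iii) the coinduction functor $\psi^*=-\square_D C:\mathcal{C}^D\to\mathcal{C}^C$ is naturally full. Moreover, if the unit object $1$ of $\mathcal{C}$ is a left $\otimes$-cogenerator, then (iii) is equivalent to (i) and (ii).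
   Context: Associativity and unit constraints are suppressed. For a coalgebra $C$ in $\mathcal{C}$, $\Delta_C$ and $\varepsilon_C:C\to1$ are its comultiplication and counit, and $\mathcal{C}^C$ (resp. ${}^C\mathcal{C}$) is the category of right (resp. left) $C$-comodules in $\mathcal{C}$. An object $X$ is flat if both $X\otimes-$ and $-\otimes X$ preserve equalizers. For a right $C$-comodule $(V,\rho)$ and a left $C$-comodule $(W,\lambda)$, $e^C_{V,W}:V\square_C W\to V\otimes W$ is the equalizer of $\rho\otimes\mathrm{Id}_W$ and $\mathrm{Id}_V\otimes\lambda$. Given a coalgebra morphism $\psi:C\to D$, $C$ is a $D$-bicomodule via $(\psi\otimes\mathrm{Id}_C)\Delta_C$ and $(\mathrm{Id}_C\otimes\psi)\Delta_C$. The coinduction functor $\psi^*=-\square_D C:\mathcal{C}^D\to\mathcal{C}^C$ sends $M$ to $M\square_D C$ with right $C$-coaction $\rho$ uniquely determined by $(e^D_{M,C}\otimes\mathrm{Id}_C)\rho=(\mathrm{Id}_M\otimes\Delta_C)e^D_{M,C}$, and sends $f:M\to N$ to the unique morphism $f\square_D C$ with $e^D_{N,C}(f\square_D C)=(f\otimes\mathrm{Id}_C)e^D_{M,C}$. An object $Q$ is a left $\otimes$-cogenerator of $\mathcal{C}$ if for any morphisms $f,g:Y\to Z\otimes W$ in $\mathcal{C}$ with $(\xi\otimes\mathrm{Id}_W)f=(\xi\otimes\mathrm{Id}_W)g$ for every $\xi:Z\to Q$ in $\mathcal{C}$, one has $f=g$. A functor $F:\mathcal{A}\to\mathcal{B}$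 induces the natural transformation $\mathcal{F}:\mathrm{Hom}_{\mathcal{A}}(-,-)\to\mathrm{Hom}_{\mathcal{B}}(F-,F-)$, $f\mapsto F(f)$. $F$ is naturally full if there is a natural transformation $\mathcal{P}:\mathrm{Hom}_{\mathcal{B}}(F-,F-)\to\mathrm{Hom}_{\mathcal{A}}(-,-)$ with $\mathcal{F}\circ\mathcal{P}=\mathrm{Id}$. *)

(* Defs.v *)
From Stdlib Require Import ssreflect ProofIrrelevance IndefiniteDescription.

Set Implicit Arguments.
Unset Strict Implicit.
Unset Printing Implicit Defensive.

Record Category : Type := {
  obj :> Type;
  hom : obj -> obj -> Type;
  idm : forall X, hom X X;
  comp : forall {X Y Z}, hom Y Z -> hom X Y -> hom X Z;
  compA : forall W X Y Z (h : hom Y Z) (g : hom X Y) (f : hom W X),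
    comp h (comp g f) = comp (comp h g) f;
  comp1m : forall X Y (f : hom X Y), comp (idm Y) f = f;
  compm1 : forall X Y (f : hom X Y), comp f (idm X) = f
}.

Arguments idm {c} X.

Declare Scope cat_scope.
Delimit Scope cat_scope with cat.
Open Scope cat_scope.

Notation "g ∘ f" := (comp g f) (at level 40, left associativity) : cat_scope.

Lemma eq_compl (A : Category) (X Y Z : A) (f f' : hom Y Z) (g : hom X Y) :
  f = f' -> f ∘ g = f' ∘ g.
Proof. by move->. Qed.

Lemma eq_compr (A : Category) (X Y Z : A) (f : hom Y Z) (g g' : hom X Y) :
  g = g' -> f ∘ g = f ∘ g'.
Proof. by move->. Qed.

Definition mono (A : Category) (X Y : A) (f : hom X Y) : Prop :=
  forall W (g h : hom W X), f ∘ g = f ∘ h -> g = h.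

Definition is_equalizer (A : Category) (E X Y : A) (e : hom E X)
    (f g : hom X Y) : Prop :=
  f ∘ e = g ∘ e /\
  forall W (h : hom W X), f ∘ h = g ∘ h -> exists! u : hom W E, e ∘ u = h.

(** Equalizers are chosen so that cotensor products are actual objects and
    coinduction is an actual functor; the choice is arbitrary. *)
Record Equalizers (A : Category) : Type := {
  eq_obj : forall (X Y : A) (f g : hom X Y), A;
  eq_arr : forall (X Y : A) (f g : hom X Y), hom (eq_obj f g) X;
  eq_arrP : forall (X Y : A) (f g : hom X Y), is_equalizer (eq_arr f g) f g
}.

Record Functor (A B : Category) : Type := {
  fobj :> A -> B;
  fmap : forall {X Y : A}, hom X Y -> hom (fobj X) (fobj Y);
  fmap_id : forall X : A, fmap (idm X) = idm (fobj X);
  fmap_comp : forall (X Y Z : A) (g : hom Y Z) (f : hom X Y),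
    fmap (g ∘ f) = fmap g ∘ fmap f
}.

Arguments fmap {A B} F {X Y} f : rename.

(** Naturality of a family [P] from Hom_B(F-,F-) to Hom_A(-,-), as functors
    on the product of the opposite of [A] with [A]. *)
Definition hom_natural (A B : Category) (F : Functor A B)
    (P : forall X Y : A, hom (F X) (F Y) -> hom X Y) : Prop :=
  forall (X X' Y Y' : A) (f : hom X' X) (g : hom Y Y') (h : hom (F X) (F Y)),
    P X' Y' (fmap F g ∘ h ∘ fmap F f) = g ∘ P X Y h ∘ f.

Definition naturally_full (A B : Category) (F : Functor A B) : Prop :=
  exists P : forall X Y : A, hom (F X) (F Y) -> hom X Y,
    hom_natural P /\
    forall (X Y : A) (h : hom (F X) (F Y)), fmap F (P X Y h) = h.

Reserved Notation "X ⊗ Y" (at level 34, left associativity).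
Reserved Notation "f ⊠ g" (at level 34, left associativity).

Record MonoidalCategory : Type := {
  mcat :> Category;
  tens : mcat -> mcat -> mcat
    where "X ⊗ Y" := (tens X Y);
  tensm : forall {X X' Y Y' : mcat},
    hom X X' -> hom Y Y' -> hom (X ⊗ Y) (X' ⊗ Y')
    where "f ⊠ g" := (tensm f g);
  tensm_id : forall X Y : mcat, idm X ⊠ idm Y = idm (X ⊗ Y);
  tensm_comp : forall (X X' X'' Y Y' Y'' : mcat)
    (f' : hom X' X'') (f : hom X X') (g' : hom Y' Y'') (g : hom Y Y'),
    (f' ∘ f) ⊠ (g' ∘ g) = (f' ⊠ g') ∘ (f ⊠ g);
  munit : mcat;
  assoc : forall X Y Z : mcat, hom ((X ⊗ Y) ⊗ Z) (X ⊗ (Y ⊗ Z));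
  assoc_inv : forall X Y Z : mcat, hom (X ⊗ (Y ⊗ Z)) ((X ⊗ Y) ⊗ Z);
  lunit : forall X : mcat, hom (munit ⊗ X) X;
  lunit_inv : forall X : mcat, hom X (munit ⊗ X);
  runit : forall X : mcat, hom (X ⊗ munit) X;
  runit_inv : forall X : mcat, hom X (X ⊗ munit);
  assocK : forall X Y Z, assoc_inv X Y Z ∘ assoc X Y Z = idm _;
  assoc_invK : forall X Y Z, assoc X Y Z ∘ assoc_inv X Y Z = idm _;
  lunitK : forall X, lunit_inv X ∘ lunit X = idm _;
  lunit_invK : forall X, lunit X ∘ lunit_inv X = idm _;
  runitK : forall X, runit_inv X ∘ runit X = idm _;
  runit_invK : forall X, runit X ∘ runit_inv X = idm _;
  assoc_nat : forall (X X' Y Y' Z Z' : mcat)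
    (f : hom X X') (g : hom Y Y') (h : hom Z Z'),
    assoc X' Y' Z' ∘ ((f ⊠ g) ⊠ h) = (f ⊠ (g ⊠ h)) ∘ assoc X Y Z;
  lunit_nat : forall (X Y : mcat) (f : hom X Y),
    lunit Y ∘ (idm munit ⊠ f) = f ∘ lunit X;
  runit_nat : forall (X Y : mcat) (f : hom X Y),
    runit Y ∘ (f ⊠ idm munit) = f ∘ runit X;
  pentagon : forall W X Y Z : mcat,
    assoc W X (Y ⊗ Z) ∘ assoc (W ⊗ X) Y Z =
    (idm W ⊠ assoc X Y Z) ∘ assoc W (X ⊗ Y) Z ∘ (assoc W X Y ⊠ idm Z);
  triangle : forall X Y : mcat,
    (idm X ⊠ lunit Y) ∘ assoc X munit Y = runit X ⊠ idm Y
}.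

Arguments assoc {m} X Y Z.
Arguments assoc_inv {m} X Y Z.
Arguments lunit {m} X.
Arguments runit {m} X.
Arguments lunit_inv {m} X.
Arguments runit_inv {m} X.

Notation "X ⊗ Y" := (tens X Y) : cat_scope.
Notation "f ⊠ g" := (tensm f g) : cat_scope.

Lemma assoc_mono (A : MonoidalCategory) (X Y Z : A) : mono (assoc X Y Z).
Proof.
by move=> W f g H; rewrite -(comp1m f) -(comp1m g) -assocK -!compA H.
Qed.

Definition flat (A : MonoidalCategory) (X : A) : Prop :=
  forall (E Y Z : A) (e : hom E Y) (f g : hom Y Z), is_equalizer e f g ->
    is_equalizer (idm X ⊠ e) (idm X ⊠ f) (idm X ⊠ g) /\
    is_equalizer (e ⊠ idm X) (f ⊠ idm X) (g ⊠ idm X).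

Definition left_tensor_cogenerator (A : MonoidalCategory) (Q : A) : Prop :=
  forall (Y Z W : A) (f g : hom Y (Z ⊗ W)),
    (forall xi : hom Z Q, (xi ⊠ idm W) ∘ f = (xi ⊠ idm W) ∘ g) -> f = g.

Record Coalgebra (A : MonoidalCategory) : Type := {
  coalg_obj :> A;
  comul : hom coalg_obj (coalg_obj ⊗ coalg_obj);
  counit : hom coalg_obj (munit A);
  comulA : assoc _ _ _ ∘ (comul ⊠ idm _) ∘ comul = (idm _ ⊠ comul) ∘ comul;
  comul_counitl : lunit _ ∘ (counit ⊠ idm _) ∘ comul = idm _;
  comul_counitr : runit _ ∘ (idm _ ⊠ counit) ∘ comul = idm _
}.

Arguments comul {A} c.
Arguments counit {A} c.

Record CoalgebraMorphism (A : MonoidalCategory) (C D : Coalgebra A) : Type := {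
  coalg_map :> hom C D;
  coalg_map_comul : comul D ∘ coalg_map = (coalg_map ⊠ coalg_map) ∘ comul C;
  coalg_map_counit : counit D ∘ coalg_map = counit C
}.

Record RightComodule (A : MonoidalCategory) (C : Coalgebra A) : Type := {
  rcomod_obj :> A;
  rcoact : hom rcomod_obj (rcomod_obj ⊗ C);
  rcoactA :
    assoc _ _ _ ∘ (rcoact ⊠ idm C) ∘ rcoact = (idm _ ⊠ comul C) ∘ rcoact;
  rcoact_counit : runit _ ∘ (idm _ ⊠ counit C) ∘ rcoact = idm _
}.

Record LeftComodule (A : MonoidalCategory) (C : Coalgebra A) : Type := {
  lcomod_obj :> A;
  lcoact : hom lcomod_obj (C ⊗ lcomod_obj);
  lcoactA :
    assoc _ _ _ ∘ (comul C ⊠ idm _) ∘ lcoact = (idm C ⊠ lcoact) ∘ lcoact;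
  lcoact_counit : lunit _ ∘ (counit C ⊠ idm _) ∘ lcoact = idm _
}.

Arguments rcoact {A C} r.
Arguments lcoact {A C} l.

Record Bicomodule (A : MonoidalCategory) (C : Coalgebra A) : Type := {
  bicomod_left :> LeftComodule C;
  bicomod_rcoact : hom bicomod_left (bicomod_left ⊗ C);
  bicomod_rcoactA :
    assoc _ _ _ ∘ (bicomod_rcoact ⊠ idm C) ∘ bicomod_rcoact =
    (idm _ ⊠ comul C) ∘ bicomod_rcoact;
  bicomod_rcoact_counit :
    runit _ ∘ (idm _ ⊠ counit C) ∘ bicomod_rcoact = idm _;
  bicomod_compat :
    assoc _ _ _ ∘ (lcoact bicomod_left ⊠ idm C) ∘ bicomod_rcoact =
    (idm C ⊠ bicomod_rcoact) ∘ lcoact bicomod_left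
}.

Arguments bicomod_rcoact {A C} b.

Definition rcolinear (A : MonoidalCategory) (C : Coalgebra A)
    (M N : RightComodule C) (f : hom M N) : Prop :=
  rcoact N ∘ f = (f ⊠ idm C) ∘ rcoact M.

Definition bicolinear (A : MonoidalCategory) (C : Coalgebra A)
    (M N : Bicomodule C) (f : hom M N) : Prop :=
  lcoact N ∘ f = (idm C ⊠ f) ∘ lcoact M /\
  bicomod_rcoact N ∘ f = (f ⊠ idm C) ∘ bicomod_rcoact M.

Arguments bicolinear {A C} M N f.

Lemma rcolinear_id (A : MonoidalCategory) (C : Coalgebra A)
  (M : RightComodule C) : rcolinear (idm M).
Proof. by rewrite /rcolinear compm1 tensm_id comp1m. Qed.

Lemma tensm_compl (A : MonoidalCategory) (X Y Z W : A)
  (g : hom Y Z) (f : hom X Y) :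
  (g ∘ f) ⊠ idm W = (g ⊠ idm W) ∘ (f ⊠ idm W).
Proof. by rewrite -tensm_comp comp1m. Qed.

Lemma tensm_compr (A : MonoidalCategory) (X Y Z W : A)
  (g : hom Y Z) (f : hom X Y) :
  idm W ⊠ (g ∘ f) = (idm W ⊠ g) ∘ (idm W ⊠ f).
Proof. by rewrite -tensm_comp comp1m. Qed.

Lemma tensm_swap (A : MonoidalCategory) (X X' Y Y' : A)
  (f : hom X X') (g : hom Y Y') :
  (f ⊠ idm Y') ∘ (idm X ⊠ g) = (idm X' ⊠ g) ∘ (f ⊠ idm Y).
Proof. by rewrite -!tensm_comp !comp1m !compm1. Qed.

Lemma rcolinear_comp (A : MonoidalCategory) (C : Coalgebra A)
  (M N P : RightComodule C) (g : hom N P) (f : hom M N) :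
  rcolinear g -> rcolinear f -> rcolinear (g ∘ f).
Proof.
rewrite /rcolinear => Hg Hf.
by rewrite compA Hg -compA Hf compA tensm_compl.
Qed.

Definition rcomod_hom (A : MonoidalCategory) (C : Coalgebra A)
  (M N : RightComodule C) : Type := {f : hom M N | rcolinear f}.

Lemma rcomod_hom_eq (A : MonoidalCategory) (C : Coalgebra A)
  (M N : RightComodule C) (f g : rcomod_hom M N) :
  proj1_sig f = proj1_sig g -> f = g.
Proof.
case: f g => [f Hf] [g Hg] /= E; subst g.
by rewrite (proof_irrelevance _ Hf Hg).
Qed.

Definition rcomod_id (A : MonoidalCategory) (C : Coalgebra A)
  (M : RightComodule C) : rcomod_hom M M := exist _ (idm M) (rcolinear_id M).

Definition rcomod_comp (A : MonoidalCategory) (C : Coalgebra A)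
    (M N P : RightComodule C) (g : rcomod_hom N P) (f : rcomod_hom M N) :
    rcomod_hom M P :=
  exist _ (proj1_sig g ∘ proj1_sig f)
    (rcolinear_comp (proj2_sig g) (proj2_sig f)).

Definition Comod (A : MonoidalCategory) (C : Coalgebra A) : Category.
Proof.
refine {| obj := RightComodule C;
          hom := @rcomod_hom A C;
          idm := @rcomod_id A C;
          comp := @rcomod_comp A C |}.
- move=> W X Y Z h g f; apply: rcomod_hom_eq; exact: compA.
- move=> X Y f; apply: rcomod_hom_eq; exact: comp1m.
- move=> X Y f; apply: rcomod_hom_eq; exact: compm1.
Defined.

Definition regular_left (A : MonoidalCategory) (D : Coalgebra A) :
    LeftComodule D :=
  {| lcomod_obj := D; lcoact := comul D;
     lcoactA := comulA D; lcoact_counit := comul_counitl D |}.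

Definition regular_bicomodule (A : MonoidalCategory) (D : Coalgebra A) :
    Bicomodule D :=
  {| bicomod_left := regular_left D; bicomod_rcoact := comul D;
     bicomod_rcoactA := comulA D; bicomod_rcoact_counit := comul_counitr D;
     bicomod_compat := comulA D |}.

Section Along.
Context (A : MonoidalCategory) (C D : Coalgebra A) (psi : CoalgebraMorphism C D).

Lemma along_lcoactA :
  assoc _ _ _ ∘ (comul D ⊠ idm C) ∘ ((psi ⊠ idm C) ∘ comul C) =
  (idm D ⊠ ((psi ⊠ idm C) ∘ comul C)) ∘ ((psi ⊠ idm C) ∘ comul C).
Proof.
rewrite compA -(compA (assoc _ _ _)) -tensm_compl coalg_map_comul tensm_compl.
rewrite (compA (assoc _ _ _)) assoc_nat -!compA (compA (assoc _ _ _)) comulA.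
rewrite !compA -!tensm_comp; apply: eq_compl.
by rewrite comp1m !compm1.
Qed.

Lemma along_lcoact_counit :
  lunit _ ∘ (counit D ⊠ idm C) ∘ ((psi ⊠ idm C) ∘ comul C) = idm C.
Proof.
rewrite compA -(compA (lunit _)) -tensm_compl coalg_map_counit.
exact: comul_counitl.
Qed.

Lemma along_rcoactA :
  assoc _ _ _ ∘ (((idm C ⊠ psi) ∘ comul C) ⊠ idm D) ∘
    ((idm C ⊠ psi) ∘ comul C) =
  (idm C ⊠ comul D) ∘ ((idm C ⊠ psi) ∘ comul C).
Proof.
rewrite (compA (idm C ⊠ comul D)) -tensm_compr coalg_map_comul tensm_compr.
rewrite -(compA (idm C ⊠ (psi ⊠ psi))) -comulA !compA -assoc_nat.
rewrite -!compA; apply: eq_compr.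
by rewrite !compA -!tensm_comp !comp1m !compm1.
Qed.

Lemma along_rcoact_counit :
  runit _ ∘ (idm C ⊠ counit D) ∘ ((idm C ⊠ psi) ∘ comul C) = idm C.
Proof.
rewrite compA -(compA (runit _)) -tensm_compr coalg_map_counit.
exact: comul_counitr.
Qed.

Lemma along_compat :
  assoc _ _ _ ∘ (((psi ⊠ idm C) ∘ comul C) ⊠ idm D) ∘
    ((idm C ⊠ psi) ∘ comul C) =
  (idm D ⊠ ((idm C ⊠ psi) ∘ comul C)) ∘ ((psi ⊠ idm C) ∘ comul C).
Proof.
transitivity ((psi ⊠ (idm C ⊠ psi)) ∘ ((idm C ⊠ comul C) ∘ comul C)).
  rewrite -comulA !compA -assoc_nat -!compA; apply: eq_compr.
  by rewrite !compA -!tensm_comp !comp1m !compm1.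
by rewrite !compA -!tensm_comp !comp1m !compm1.
Qed.

Definition left_along : LeftComodule D :=
  {| lcomod_obj := C; lcoact := (psi ⊠ idm C) ∘ comul C;
     lcoactA := along_lcoactA; lcoact_counit := along_lcoact_counit |}.

Definition bicomodule_along : Bicomodule D :=
  {| bicomod_left := left_along;
     bicomod_rcoact := (idm C ⊠ psi) ∘ comul C;
     bicomod_rcoactA := along_rcoactA;
     bicomod_rcoact_counit := along_rcoact_counit;
     bicomod_compat := along_compat |}.

End Along.

Section Cotensor.
Context (A : MonoidalCategory) (Eq : Equalizers A) (C : Coalgebra A).
Context (V : RightComodule C) (W : LeftComodule C).

Definition cotens : A :=
  eq_obj Eq (assoc V C W ∘ (rcoact V ⊠ idm W)) (idm V ⊠ lcoact W).

Definition cotens_arr : hom cotens (V ⊗ W) :=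
  eq_arr Eq (assoc V C W ∘ (rcoact V ⊠ idm W)) (idm V ⊠ lcoact W).

Lemma cotens_arrP :
  is_equalizer cotens_arr
    (assoc V C W ∘ (rcoact V ⊠ idm W)) (idm V ⊠ lcoact W).
Proof. exact: eq_arrP. Qed.

End Cotensor.

Lemma equalizer_mono (A : Category) (E X Y : A) (e : hom E X) (f g : hom X Y) :
  is_equalizer e f g -> mono e.
Proof.
move=> [He U] W h k E1.
have H : f ∘ (e ∘ h) = g ∘ (e ∘ h) by rewrite !compA He.
have [u [_ Hu]] := U _ _ H.
by rewrite -(Hu h) // -(Hu k).
Qed.

Definition equalizer_lift (A : Category) (E X Y : A) (e : hom E X)
    (f g : hom X Y) (H : is_equalizer e f g) (W : A) (h : hom W X)
    (Hh : f ∘ h = g ∘ h) : {u : hom W E | e ∘ u = h} :=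
  constructive_definite_description _ (proj2 H W h Hh).

Lemma runit_tens (A : MonoidalCategory) (X Y : A) :
  (idm X ⊠ runit Y) ∘ assoc X Y (munit A) = runit (X ⊗ Y).
Proof.
have faithful (U V : A) (f g : hom U V) :
  f ⊠ idm (munit A) = g ⊠ idm (munit A) -> f = g.
  move=> H.
  rewrite -(compm1 f) -(compm1 g) -(runit_invK U) !compA.
  by rewrite -(runit_nat f) -(runit_nat g) H.
apply: faithful.
apply: assoc_mono; rewrite -triangle tensm_compl !compA assoc_nat.
rewrite -tensm_id assoc_nat -(compA (idm X ⊠ (idm Y ⊠ _))) pentagon !compA.
by rewrite -tensm_compr triangle.
Qed.

Section Coinduction.
Context (A : MonoidalCategory) (Eq : Equalizers A)
  (flatA : forall X : A, flat X).
Context (C D : Coalgebra A) (psi : CoalgebraMorphism C D).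

Section Object.
Context (M : RightComodule D).

Let K : A := cotens Eq M (left_along psi).
Let e : hom K (M ⊗ C) := cotens_arr Eq M (left_along psi).
Let eP := cotens_arrP Eq M (left_along psi).

Lemma coind_arr_tensP (X : A) :
  is_equalizer (e ⊠ idm X)
    ((assoc M D C ∘ (rcoact M ⊠ idm C)) ⊠ idm X)
    ((idm M ⊠ ((psi ⊠ idm C) ∘ comul C)) ⊠ idm X).
Proof. exact: (proj2 (flatA X eP)). Qed.

Lemma coind_liftable :
  ((assoc M D C ∘ (rcoact M ⊠ idm C)) ⊠ idm C) ∘
    (assoc_inv _ _ _ ∘ (idm M ⊠ comul C) ∘ e) =
  ((idm M ⊠ ((psi ⊠ idm C) ∘ comul C)) ⊠ idm C) ∘
    (assoc_inv _ _ _ ∘ (idm M ⊠ comul C) ∘ e).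
Proof.
have inv_nat (X X' Y Y' Z Z' : A)
    (f : hom X X') (g : hom Y Y') (h : hom Z Z') :
    ((f ⊠ g) ⊠ h) ∘ assoc_inv X Y Z = assoc_inv X' Y' Z' ∘ (f ⊠ (g ⊠ h)).
  rewrite -(comp1m (_ ∘ assoc_inv X Y Z)) -assocK -!compA; apply: eq_compr.
  by rewrite !compA assoc_nat -compA assoc_invK compm1.
have cancel (U : A) (f g : hom U ((M ⊗ (D ⊗ C)) ⊗ C)) :
  (idm M ⊠ assoc _ _ _) ∘ (assoc _ _ _ ∘ f) =
  (idm M ⊠ assoc _ _ _) ∘ (assoc _ _ _ ∘ g) -> f = g.
  move=> H; rewrite -(comp1m f) -(comp1m g) -assocK -!compA; apply: eq_compr.
  rewrite -(comp1m (assoc _ _ _ ∘ f)) -(comp1m (assoc _ _ _ ∘ g)).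
  by rewrite -tensm_id -(assocK D C C) tensm_compr -!compA H.
have E : (assoc M D C ∘ (rcoact M ⊠ idm C)) ∘ e =
  (idm M ⊠ ((psi ⊠ idm C) ∘ comul C)) ∘ e := proj1 eP.
have B : assoc D C C ∘ (((psi ⊠ idm C) ∘ comul C) ⊠ idm C) ∘ comul C =
  (idm D ⊠ comul C) ∘ ((psi ⊠ idm C) ∘ comul C).
  rewrite tensm_compl !compA assoc_nat -!compA (compA (assoc _ _ _)) comulA.
  by rewrite !compA -!tensm_comp !tensm_id !comp1m !compm1.
apply: cancel.
transitivity ((idm M ⊠ (idm D ⊠ comul C)) ∘
  ((assoc M D C ∘ (rcoact M ⊠ idm C)) ∘ e)).
  rewrite tensm_compl !compA -pentagon -(compA _ ((rcoact M ⊠ idm C) ⊠ idm C)).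
  rewrite inv_nat !compA -(compA _ (assoc _ _ _) (assoc_inv _ _ _)).
  rewrite assoc_invK compm1 -assoc_nat -!(compA (assoc M D (C ⊗ C))).
  by rewrite !tensm_id -!tensm_comp !comp1m !compm1.
rewrite E !compA; apply: eq_compl.
rewrite -(compA _ ((idm M ⊠ _) ⊠ _)) inv_nat !compA.
rewrite -(compA _ (assoc _ _ _) (assoc_inv _ _ _)) assoc_invK compm1.
by rewrite -!tensm_compr B !compA.
Qed.

Definition coind_coact : hom K (K ⊗ C) :=
  proj1_sig (equalizer_lift (coind_arr_tensP C) coind_liftable).

Lemma coind_coactP :
  assoc _ _ _ ∘ (e ⊠ idm C) ∘ coind_coact = (idm M ⊠ comul C) ∘ e.
Proof.
rewrite -compA /coind_coact (proj2_sig (equalizer_lift _ _)).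
by rewrite !compA assoc_invK comp1m.
Qed.

Lemma coind_coact_eq :
  (e ⊠ idm C) ∘ coind_coact = assoc_inv _ _ _ ∘ (idm M ⊠ comul C) ∘ e.
Proof. exact: (proj2_sig (equalizer_lift _ _)). Qed.

Lemma coind_coactA :
  assoc _ _ _ ∘ (coind_coact ⊠ idm C) ∘ coind_coact =
  (idm _ ⊠ comul C) ∘ coind_coact.
Proof.
apply: (equalizer_mono (coind_arr_tensP (C ⊗ C))).
apply: assoc_mono.
transitivity ((idm M ⊠ (assoc C C C ∘ (comul C ⊠ idm C) ∘ comul C)) ∘ e).
  rewrite -(tensm_id C C) !compA -(compA (assoc _ _ _) (e ⊠ _)) -assoc_nat.
  rewrite !compA pentagon -!compA (compA (_ ⊠ _) (coind_coact ⊠ _)).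
  rewrite -tensm_compl (compA (assoc M C C ⊠ _)) -tensm_compl compA.
  rewrite (compA (assoc M C C)) coind_coactP tensm_compl !compA.
  rewrite -(compA _ (assoc _ _ _) ((_ ⊠ _) ⊠ _)) assoc_nat -!compA.
  rewrite (compA (assoc _ _ _)) (compA _ (assoc M C C ∘ _)) .
  rewrite (compA (idm M ⊠ (comul C ⊠ idm C))) (compA (idm M ⊠ assoc _ _ _)).
  by rewrite -!compA (compA (assoc M C C)) coind_coactP !compA -!tensm_compr.
rewrite comulA tensm_compr -compA -coind_coactP !compA.
rewrite -(compA _ (e ⊠ idm (C ⊗ C))) tensm_swap !compA.
by rewrite -(tensm_id M C) assoc_nat.
Qed.

Lemma coind_coact_counit :
  runit _ ∘ (idm _ ⊠ counit C) ∘ coind_coact = idm _.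
Proof.
apply: (equalizer_mono eP); rewrite -/e compm1 !compA -runit_nat.
rewrite -(compA (runit _)) tensm_swap -!compA coind_coact_eq.
rewrite -runit_tens -(tensm_id M C) !compA.
rewrite -(compA _ (assoc _ _ _)) assoc_nat compA.
rewrite -(compA _ (assoc _ _ _)) assoc_invK compm1 -!tensm_compr.
by rewrite comul_counitr tensm_id comp1m.
Qed.

Definition coind_obj : RightComodule C :=
  {| rcomod_obj := cotens Eq M (left_along psi); rcoact := coind_coact;
     rcoactA := coind_coactA; rcoact_counit := coind_coact_counit |}.

End Object.

Section Morphism.
Context (M N : RightComodule D) (f : rcomod_hom M N).

Lemma coind_map_liftable :
  (assoc N D C ∘ (rcoact N ⊠ idm C)) ∘
    ((proj1_sig f ⊠ idm C) ∘ cotens_arr Eq M (left_along psi)) =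
  (idm N ⊠ lcoact (left_along psi)) ∘
    ((proj1_sig f ⊠ idm C) ∘ cotens_arr Eq M (left_along psi)).
Proof.
have E := proj1 (cotens_arrP Eq M (left_along psi)).
rewrite (compA (idm N ⊠ _)) -tensm_swap -!compA -E.
rewrite (compA (rcoact N ⊠ _)) -tensm_compl (proj2_sig f) tensm_compl.
by rewrite -(tensm_id D C) !compA assoc_nat.
Qed.

Definition coind_map_arr : hom (coind_obj M) (coind_obj N) :=
  proj1_sig (equalizer_lift (cotens_arrP Eq N (left_along psi))
               coind_map_liftable).

Lemma coind_map_arrP :
  cotens_arr Eq N (left_along psi) ∘ coind_map_arr =
  (proj1_sig f ⊠ idm C) ∘ cotens_arr Eq M (left_along psi).
Proof. exact: (proj2_sig (equalizer_lift _ _)). Qed.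

Lemma coind_map_colinear : rcolinear coind_map_arr.
Proof.
rewrite /rcolinear /=; apply: (equalizer_mono (coind_arr_tensP N C)).
apply: assoc_mono; rewrite !compA coind_coactP -!compA coind_map_arrP.
rewrite (compA (_ ⊠ idm C) (coind_map_arr ⊠ _)) -tensm_compl coind_map_arrP.
rewrite tensm_compl !compA assoc_nat tensm_id -!compA (compA (assoc M C C)).
by rewrite coind_coactP !compA tensm_swap.
Qed.

Definition coind_map : rcomod_hom (coind_obj M) (coind_obj N) :=
  exist _ coind_map_arr coind_map_colinear.

End Morphism.

Definition coinduction : Functor (Comod D) (Comod C).
Proof.
refine (@Build_Functor (Comod D) (Comod C) coind_obj coind_map _ _).
- move=> M; apply: rcomod_hom_eq.
  apply: (equalizer_mono (cotens_arrP Eq M (left_along psi))).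
  by rewrite coind_map_arrP /= tensm_id comp1m compm1.
- move=> M N P g f; apply: rcomod_hom_eq.
  apply: (equalizer_mono (cotens_arrP Eq P (left_along psi))).
  rewrite coind_map_arrP /= compA coind_map_arrP -compA coind_map_arrP.
  by rewrite compA tensm_compl.
Defined.

End Coinduction.

(* Main.v *)
From Stdlib Require Import ssreflect.
Require Import Defs.

Set Implicit Arguments.
Unset Strict Implicit.
Unset Printing Implicit Defensive.

(** Coinduction is right adjoint to corestriction along [psi], with counit
    [p_M = (M ⊗ ε_C) e_M] and unit the coaction. Hence it is naturally full iff
    the counit has a natural colinear retraction [s_M : M -> M □ C], in the form
    [(s_M ⊗ C) e_M = ρ_(M □ C)]. A bicomodule retraction [χ] of [psi] gives
    [s_M = (M ⊗ χ) ρ_M]. Conversely [χ] is [s_D] followed by [D □ C ≅ C]; the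
    naturality of [s] at the endomorphisms [(ξ ⊗ D) Δ_D] of [D], for
    [ξ : D -> 1], gives left colinearity of [χ] after applying any [ξ], which is
    enough when [1] is a left cogenerator. *)

(** * Coherence of the left unit and the associator *)

Section Monoidal.
Context (A : MonoidalCategory).

Lemma lunit_faithful (U V : A) (f g : hom U V) :
  idm (munit A) ⊠ f = idm (munit A) ⊠ g -> f = g.
Proof.
move=> H; rewrite -(compm1 f) -(compm1 g) -(lunit_invK U) !compA.
by rewrite -(lunit_nat f) -(lunit_nat g) H.
Qed.

Lemma assoc_epi (X Y Z T : A) (f g : hom (X ⊗ (Y ⊗ Z)) T) :
  f ∘ assoc X Y Z = g ∘ assoc X Y Z -> f = g.
Proof.
by move=> H; rewrite -(compm1 f) -(compm1 g) -assoc_invK !compA H.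
Qed.

(** Kelly's argument: [1 ⊗ -] is faithful, so it suffices to compare the two sides after tensoring
    with [1] on the left, where the pentagon and two triangles decide. *)
Lemma lunit_tens (X Y : A) :
  lunit (X ⊗ Y) ∘ assoc (munit A) X Y = lunit X ⊠ idm Y.
Proof.
apply: lunit_faithful; rewrite tensm_compr; apply: assoc_epi.
(* Inserting an associator and its inverse on the right supplies the edge that the pentagon needs;
   the inverse is then cancelled from both sides. *)
rewrite -[LHS]compm1 -[RHS]compm1 -tensm_id -(assoc_invK (munit A)).
rewrite tensm_compl !compA; apply: eq_compl.
rewrite -!(compA (idm _ ⊠ lunit (X ⊗ Y))) -pentagon compA triangle.
rewrite -(tensm_id X Y) -assoc_nat -assoc_nat -compA -tensm_compl triangle //.
Qed.

Lemma assoc_inv_nat (X X' Y Y' Z Z' : A)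
    (f : hom X X') (g : hom Y Y') (h : hom Z Z') :
  ((f ⊠ g) ⊠ h) ∘ assoc_inv X Y Z = assoc_inv X' Y' Z' ∘ (f ⊠ (g ⊠ h)).
Proof.
apply: assoc_mono.
by rewrite !compA assoc_nat -compA !assoc_invK compm1 comp1m.
Qed.

End Monoidal.

(** * Corestriction of right comodules along [psi] *)

Section Corestriction.
Context (A : MonoidalCategory) (C D : Coalgebra A).
Context (psi : CoalgebraMorphism C D) (V : RightComodule C).

Lemma corestrict_coactA :
  assoc _ _ _ ∘ (((idm V ⊠ psi) ∘ rcoact V) ⊠ idm D) ∘
    ((idm V ⊠ psi) ∘ rcoact V) =
  (idm V ⊠ comul D) ∘ ((idm V ⊠ psi) ∘ rcoact V).
Proof.
rewrite (compA (idm V ⊠ comul D)) -tensm_compr coalg_map_comul tensm_compr.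
rewrite -(compA (idm V ⊠ (psi ⊠ psi))) -rcoactA !compA -assoc_nat.
rewrite -!compA; apply: eq_compr.
by rewrite !compA -!tensm_comp !comp1m !compm1.
Qed.

Lemma corestrict_coact_counit :
  runit _ ∘ (idm V ⊠ counit D) ∘ ((idm V ⊠ psi) ∘ rcoact V) = idm V.
Proof.
rewrite compA -(compA (runit _)) -tensm_compr coalg_map_counit.
exact: rcoact_counit.
Qed.

Definition corestrict : RightComodule D :=
  {| rcomod_obj := V; rcoact := (idm V ⊠ psi) ∘ rcoact V;
     rcoactA := corestrict_coactA;
     rcoact_counit := corestrict_coact_counit |}.

End Corestriction.

Lemma corestrict_colinear (A : MonoidalCategory) (C D : Coalgebra A)
    (psi : CoalgebraMorphism C D) (V W : RightComodule C) (f : hom V W) :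
  rcolinear f ->
  rcolinear (M := corestrict psi V) (N := corestrict psi W) f.
Proof.
by rewrite /rcolinear /= => H; rewrite -compA H !compA -tensm_swap.
Qed.

Definition corestrict_map (A : MonoidalCategory) (C D : Coalgebra A)
    (psi : CoalgebraMorphism C D) (V W : RightComodule C)
    (f : rcomod_hom V W) :
    rcomod_hom (corestrict psi V) (corestrict psi W) :=
  exist _ (proj1_sig f) (corestrict_colinear psi (proj2_sig f)).

Definition regular_right (A : MonoidalCategory) (D : Coalgebra A) :
    RightComodule D :=
  {| rcomod_obj := D; rcoact := comul D;
     rcoactA := comulA D; rcoact_counit := comul_counitr D |}.

(** * The adjunction between corestriction and coinduction, and natural fullness in terms of its
    counit *)

Section Adjunction.
Context (A : MonoidalCategory) (Eq : Equalizers A)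
  (flatA : forall X : A, flat X).
Context (C D : Coalgebra A) (psi : CoalgebraMorphism C D).

Local Notation F := (coind_obj Eq flatA psi).
Local Notation G := (corestrict psi).
Local Notation e M := (cotens_arr Eq M (left_along psi)).

Lemma cotens_arr_eq (M : RightComodule D) :
  assoc M D C ∘ (rcoact M ⊠ idm C) ∘ e M =
  (idm M ⊠ ((psi ⊠ idm C) ∘ comul C)) ∘ e M.
Proof. exact: proj1 (cotens_arrP Eq M (left_along psi)). Qed.

Lemma cotens_arr_mono (M : RightComodule D) : mono (e M).
Proof. exact: equalizer_mono (cotens_arrP Eq M (left_along psi)). Qed.

Definition coind_counit (M : RightComodule D) : hom (F M) M :=
  runit M ∘ (idm M ⊠ counit C) ∘ e M.

(** The coaction of [F M] is [M ⊗ Δ_C] seen through [e M], and [ε_C] cancels the left leg of [Δ_C].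
    Thus [e M] can be recovered from the counit. *)
Lemma coind_counit_coact (M : RightComodule D) :
  (coind_counit M ⊠ idm C) ∘ rcoact (F M) = e M.
Proof.
rewrite /coind_counit !tensm_compl -compA coind_coact_eq -triangle.
rewrite !compA -(compA _ ((idm M ⊠ counit C) ⊠ idm C)) assoc_inv_nat.
rewrite !compA -(compA _ (assoc _ _ _)) assoc_invK compm1 -!tensm_compr.
by rewrite comul_counitl tensm_id comp1m.
Qed.

(** On the equalizer, [ρ_M] may be traded for the left [D]-coaction of [C]; then [ε_C] cancels the
    right leg of [Δ_C] and leaves [psi]. *)
Lemma coact_coind_counit (M : RightComodule D) :
  rcoact M ∘ coind_counit M = (idm M ⊠ psi) ∘ e M.
Proof.
rewrite /coind_counit !compA -runit_nat -(compA (runit _)) tensm_swap.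
rewrite -runit_tens -(tensm_id M D) !compA -(compA _ (assoc _ _ _)) assoc_nat.
rewrite -!compA (compA (assoc _ _ _)) cotens_arr_eq !compA -!tensm_compr.
congr ((_ ⊠ _) ∘ _).
rewrite !compA -(compA (runit D)) -tensm_swap compA runit_nat.
by rewrite -!compA (compA (runit C)) comul_counitr compm1.
Qed.

Lemma coind_counit_colinear (M : RightComodule D) :
  rcolinear (M := G (F M)) (coind_counit M).
Proof.
rewrite /rcolinear coact_coind_counit [rcoact (G _)]/= compA tensm_swap.
by rewrite -compA coind_counit_coact.
Qed.

Lemma coind_counit_nat (M N : RightComodule D) (f : rcomod_hom M N) :
  coind_counit N ∘ coind_map_arr Eq flatA psi f =
  proj1_sig f ∘ coind_counit M.
Proof.
rewrite /coind_counit -!compA coind_map_arrP !compA.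
by rewrite -(runit_nat (proj1_sig f)) -!(compA (runit N)) tensm_swap.
Qed.

Section Unit.
Context (V : RightComodule C).

Lemma coind_unit_liftable :
  assoc (G V) D C ∘ (rcoact (G V) ⊠ idm C) ∘ rcoact V =
  (idm (G V) ⊠ lcoact (left_along psi)) ∘ rcoact V.
Proof.
rewrite /= tensm_compl compA assoc_nat tensm_compr -[RHS]compA -rcoactA.
by rewrite !compA.
Qed.

Definition coind_unit_arr : hom V (F (G V)) :=
  proj1_sig (equalizer_lift (cotens_arrP Eq (G V) (left_along psi))
               coind_unit_liftable).

Lemma coind_unit_arrP : e (G V) ∘ coind_unit_arr = rcoact V.
Proof. exact: (proj2_sig (equalizer_lift _ _)). Qed.

Lemma coind_unit_colinear : rcolinear (N := F (G V)) coind_unit_arr.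
Proof.
apply: (equalizer_mono (coind_arr_tensP Eq flatA psi (G V) C)).
apply: assoc_mono; rewrite !compA coind_coactP -!compA.
rewrite coind_unit_arrP (compA (e (G V) ⊠ _)) -tensm_compl.
by rewrite coind_unit_arrP compA rcoactA.
Qed.

Definition coind_unit : rcomod_hom V (F (G V)) :=
  exist _ coind_unit_arr coind_unit_colinear.

End Unit.

Lemma coind_unit_nat (V W : RightComodule C) (f : rcomod_hom V W) :
  coind_unit_arr W ∘ proj1_sig f =
  coind_map_arr Eq flatA psi (corestrict_map psi f) ∘ coind_unit_arr V.
Proof.
apply: cotens_arr_mono; rewrite !compA coind_unit_arrP coind_map_arrP -compA.
rewrite coind_unit_arrP; exact: (proj2_sig f).
Qed.

(** The last clause encodes [s M ∘ coind_counit M = idm]: applying [ε_C] to it gives that identity,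
    and the converse follows from [coind_counit_coact]. *)
Definition coind_retraction (s : forall M : RightComodule D, hom M (F M)) :=
  (forall M, rcolinear (N := G (F M)) (s M)) /\
  (forall (M N : RightComodule D) (f : rcomod_hom M N),
     s N ∘ proj1_sig f = coind_map_arr Eq flatA psi f ∘ s M) /\
  (forall M, (s M ⊠ idm C) ∘ e M = rcoact (F M)).

Lemma coind_retractionK s M :
  coind_retraction s -> s M ∘ coind_counit M = idm (F M).
Proof.
case=> _ [_ sE]; rewrite /coind_counit !compA -runit_nat -(compA (runit _)).
by rewrite tensm_swap -!compA sE compA rcoact_counit.
Qed.

(** A map [h : F M -> F N] is lifted to [p_N h s_M], where [p] is the counit. Its image under
    coinduction is [h] because [h] is colinear and [(p_N ⊗ C) ρ = e N]. *)
Lemma retraction_naturally_full s :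
  coind_retraction s -> naturally_full (coinduction Eq flatA psi).
Proof.
case=> s_lin [s_nat sE].
have P_lin (M N : RightComodule D) (h : rcomod_hom (F M) (F N)) :
    rcolinear (coind_counit N ∘ proj1_sig h ∘ s M).
  apply: (rcolinear_comp (N := G (F M))) (s_lin M).
  apply: (rcolinear_comp (N := G (F N))) (coind_counit_colinear N) _.
  exact: corestrict_colinear (proj2_sig h).
exists (fun M N h => exist _ _ (P_lin M N h)); split.
- move=> M M' N N' f g h; apply: rcomod_hom_eq => /=.
  by rewrite !compA coind_counit_nat -!compA s_nat.
- move=> M N h; apply: rcomod_hom_eq; apply: cotens_arr_mono.
  rewrite coind_map_arrP /= 2!tensm_compl -!compA sE.
  by rewrite -(proj2_sig h) compA coind_counit_coact.
Qed.

Lemma naturally_full_retraction :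
  naturally_full (coinduction Eq flatA psi) -> exists s, coind_retraction s.
Proof.
case=> P [P_nat PK].
(* The unit at [F M] is a map between coinduced comodules, so [P] lifts it to [M -> G (F M)]. *)
exists (fun M => proj1_sig (P M (G (F M)) (coind_unit (F M)))).
split; first by move=> M; exact: (proj2_sig (P _ _ _)).
split; last first.
  move=> M; rewrite -(coind_unit_arrP (F M)).
  have <- : coind_map_arr Eq flatA psi (P _ _ (coind_unit (F M))) =
      coind_unit_arr (F M) := f_equal (@proj1_sig _ _) (PK _ _ _).
  by rewrite coind_map_arrP.
move=> M N f.
pose Ff := coind_map Eq flatA psi f.
pose GFf := corestrict_map psi Ff.
(* Naturality of [P] in each variable writes both sides as values of [P]; their arguments agree by
   naturality of the unit. *)
have L := P_nat _ _ _ _ f (idm (G (F N) : Comod D)) (coind_unit (F N)).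
have R := P_nat _ _ _ _ (idm (M : Comod D)) GFf (coind_unit (F M)).
rewrite fmap_id comp1m comp1m in L; rewrite fmap_id compm1 compm1 in R.
apply: eq_trans (f_equal (@proj1_sig _ _) (eq_sym L)) _.
apply: eq_trans _ (f_equal (@proj1_sig _ _) R).
congr (proj1_sig (P _ _ _)); apply: rcomod_hom_eq; exact: coind_unit_nat.
Qed.

(** * From a bicomodule map [chi] to a retraction of the counit *)

Section FromChi.
Context (chi : hom D C).
Hypothesis chi_lin :
  bicolinear (regular_bicomodule D) (bicomodule_along psi) chi.

Let chi_left : (psi ⊠ idm C) ∘ comul C ∘ chi = (idm D ⊠ chi) ∘ comul D.
Proof. exact: (proj1 chi_lin). Qed.

Let chi_right : (idm C ⊠ psi) ∘ comul C ∘ chi = (chi ⊠ idm D) ∘ comul D.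
Proof. exact: (proj2 chi_lin). Qed.

(** Right colinearity gives [ψχ = (ε_C χ ⊗ D) Δ_D]; since [psi] is comultiplicative, precomposing
    with it yields [(ε_C χψ ⊗ ψ) Δ_C], which is [psi] by the counit law. *)
Lemma bicolinear_counit_retraction :
  counit C ∘ chi ∘ psi = counit C -> psi ∘ chi ∘ psi = psi.
Proof.
move=> H.
have E : psi ∘ chi = lunit D ∘ ((counit C ∘ chi) ⊠ idm D) ∘ comul D.
  rewrite tensm_compl -!compA -chi_right !compA -(compA (lunit D)) tensm_swap.
  rewrite !compA lunit_nat -!(compA psi) comul_counitl comp1m //.
rewrite E -(compA _ (comul D)) coalg_map_comul compA -(compA (lunit D)).
rewrite -tensm_comp H comp1m -{1}(comp1m (counit C)) -{1}(compm1 psi).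
rewrite tensm_comp compA lunit_nat.
by rewrite -!compA (compA (lunit C)) comul_counitl compm1.
Qed.

Section Arrow.
Context (M : RightComodule D).

Lemma chi_section_liftable :
  assoc M D C ∘ (rcoact M ⊠ idm C) ∘ ((idm M ⊠ chi) ∘ rcoact M) =
  (idm M ⊠ lcoact (left_along psi)) ∘ ((idm M ⊠ chi) ∘ rcoact M).
Proof.
rewrite /= (compA (idm M ⊠ (_ ∘ _))) -tensm_compr chi_left tensm_compr.
rewrite -[RHS]compA -rcoactA !compA -assoc_nat tensm_id.
by rewrite -!(compA (assoc _ _ _)) tensm_swap.
Qed.

Definition chi_section : hom M (F M) :=
  proj1_sig (equalizer_lift (cotens_arrP Eq M (left_along psi))
               chi_section_liftable).

Lemma chi_sectionP : e M ∘ chi_section = (idm M ⊠ chi) ∘ rcoact M.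
Proof. exact: (proj2_sig (equalizer_lift _ _)). Qed.

End Arrow.

Lemma chi_section_retraction :
  chi ∘ psi = idm C -> coind_retraction chi_section.
Proof.
move=> chiK; split; [|split].
- move=> M; apply: (equalizer_mono (coind_arr_tensP Eq flatA psi M D)).
  apply: assoc_mono; rewrite /= !compA.
  rewrite -(compA _ (e M ⊠ idm D)) tensm_swap compA -(tensm_id M C) assoc_nat.
  rewrite -(compA _ (assoc _ _ _)) -(compA _ (assoc _ _ _ ∘ _)) coind_coactP.
  rewrite -!compA chi_sectionP (compA (e M ⊠ _)) -tensm_compl chi_sectionP.
  rewrite !compA -!tensm_compr chi_right tensm_compl !compA assoc_nat.
  by rewrite tensm_compr -2!compA -rcoactA !compA.
- move=> M N f; apply: cotens_arr_mono; rewrite !compA.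
  rewrite chi_sectionP coind_map_arrP.
  rewrite -!compA chi_sectionP (proj2_sig f) !compA.
  by rewrite -tensm_swap.
(* The equalizer equation turns [ρ_M] into [psi] followed by [chi] on the left leg of [Δ_C], and
   [chiK] removes both. *)
- move=> M; apply: (equalizer_mono (coind_arr_tensP Eq flatA psi M C)).
  rewrite compA -tensm_compl chi_sectionP; apply: assoc_mono.
  rewrite [RHS]compA coind_coactP tensm_compl !compA assoc_nat.
  rewrite -!compA (compA (assoc _ _ _)) cotens_arr_eq !compA -!tensm_compr.
  by rewrite compA -tensm_compl chiK tensm_id comp1m.
Qed.

End FromChi.

(** * From a retraction of the counit to a bicomodule map [chi] *)

Section ToChi.
Context (s : forall M : RightComodule D, hom M (F M)).
Hypothesis sP : coind_retraction s.

Let D0 : RightComodule D := regular_right D.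

Definition cotens_regular : hom (F D0) C :=
  lunit C ∘ (counit D ⊠ idm C) ∘ e D0.

(** Apply [ε_D] to the first factor of the equalizer equation for [D □ C]. *)
Lemma cotens_regularP : e D0 = (psi ⊠ idm C) ∘ comul C ∘ cotens_regular.
Proof.
rewrite /cotens_regular !compA -lunit_nat -(compA (lunit _)) -tensm_swap.
rewrite -!compA -cotens_arr_eq !compA -(tensm_id D C).
rewrite -(compA _ _ (assoc _ _ _)) -assoc_nat.
rewrite compA lunit_tens -!tensm_compl comul_counitl tensm_id comp1m //.
Qed.

Lemma cotens_regular_colinear :
  comul C ∘ cotens_regular = (cotens_regular ⊠ idm C) ∘ rcoact (F D0).
Proof.
rewrite /cotens_regular !tensm_compl -!compA coind_coact_eq.
rewrite !compA -(compA _ ((counit D ⊠ idm C) ⊠ idm C)) assoc_inv_nat.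
rewrite -lunit_tens !compA -(compA _ (assoc _ _ _)) assoc_invK compm1.
by rewrite tensm_id -!(compA (lunit _)) tensm_swap !compA lunit_nat.
Qed.

(** Under [D □ C ≅ C] the counit at [D] becomes [psi], so a retraction of the former gives one of
    the latter. *)
Lemma coind_counit_regular : coind_counit D0 = psi ∘ cotens_regular.
Proof.
rewrite /coind_counit cotens_regularP !compA -(compA (runit _)) -tensm_swap.
rewrite compA runit_nat -!compA (compA (runit C)) (compA _ (comul C)).
by rewrite comul_counitr comp1m.
Qed.

Lemma cotens_regular_section :
  exists u : hom C (F D0), cotens_regular ∘ u = idm C.
Proof.
have psi_lin : rcolinear (M := G (regular_right C)) (N := D0) psi.
  rewrite /rcolinear /= coalg_map_comul compA -tensm_comp comp1m compm1 //.
pose psi_map : rcomod_hom (G (regular_right C)) D0 := exist _ _ psi_lin.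
(* This is the adjunct of [psi : C -> D]; through [e D0] it reads [(ψ ⊗ C) Δ_C]. *)
exists (coind_map_arr Eq flatA psi psi_map ∘
        coind_unit_arr (regular_right C)).
rewrite /cotens_regular !compA -(compA _ (e D0)) coind_map_arrP.
rewrite -!compA (coind_unit_arrP (regular_right C)) /= !compA.
rewrite -(compA (lunit C)) -tensm_compl.
by rewrite coalg_map_counit comul_counitl.
Qed.

Lemma retraction_bicolinear :
  left_tensor_cogenerator (munit A) ->
  exists chi : hom D C,
    bicolinear (regular_bicomodule D) (bicomodule_along psi) chi /\
    chi ∘ psi = idm C.
Proof.
move=> cogen; exists (cotens_regular ∘ s D0); split; [split => /=|].
- apply: cogen => xi.
  (* Coassociativity makes convolution by [xi] on the left a right colinear endomorphism of [D], at
     which [s] can be tested. *)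
  have f_lin : rcolinear (M := D0) (N := D0) (lunit D ∘ (xi ⊠ idm D) ∘ comul D).
    rewrite /rcolinear /= !compA -lunit_nat -(compA (lunit _)) -tensm_swap.
    rewrite -!compA -comulA !tensm_compl -lunit_tens !compA.
    by rewrite -(compA (lunit _) (assoc _ _ _)) assoc_nat tensm_id !compA.
  pose f : rcomod_hom D0 D0 := exist _ _ f_lin.
  have N := proj1 (proj2 sP) _ _ f.
  (* The equalizer equation moves [Δ_D] onto [C], where [ε_D] cancels the coaction and only [xi]
     remains. *)
  have H : cotens_regular ∘ coind_map_arr Eq flatA psi f =
      lunit C ∘ (xi ⊠ idm C) ∘ e D0.
    rewrite /cotens_regular -!compA coind_map_arrP /= !tensm_compl -lunit_tens.
    rewrite -!compA (compA (assoc _ _ _) ((xi ⊠ idm D) ⊠ _)) assoc_nat.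
    rewrite -!compA (compA (assoc _ _ _)) cotens_arr_eq tensm_id.
    rewrite (compA (xi ⊠ _)) tensm_swap -!compA (compA (lunit (D ⊗ C))).
    rewrite lunit_nat !compA -(compA _ _ (comul C)).
    by rewrite along_lcoact_counit comp1m.
  have lunit_mono : mono (lunit C).
    by move=> W g h E; rewrite -(comp1m g) -(comp1m h) -lunitK -!compA E.
  apply: lunit_mono; rewrite (compA _ cotens_regular) -cotens_regularP.
  rewrite !compA -H -(compA cotens_regular) -N /= -(compA (lunit C)) tensm_swap.
  by rewrite (compA (lunit C)) lunit_nat !compA.
- rewrite compA -(compA _ (comul C)) cotens_regular_colinear tensm_compl.
  rewrite compA -tensm_swap -!compA; congr (_ ∘ _).
  rewrite compA; exact: (proj1 sP D0).
- have [u uK] := cotens_regular_section.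
  (* Inserting the section [u] turns [psi] into the counit at [D] followed after [u], which [s D0]
     cancels. *)
  rewrite -(compm1 psi) -uK -(compA cotens_regular) (compA psi).
  rewrite -coind_counit_regular (compA (s D0)).
  by rewrite (coind_retractionK D0 sP) comp1m.
Qed.

End ToChi.
End Adjunction.

Theorem proposition4p6 (A : MonoidalCategory) (Eq : Equalizers A)
    (flatA : forall X : A, flat X)
    (C D : Coalgebra A) (psi : CoalgebraMorphism C D) :
  let cond_i :=
    exists chi : hom D C,
      bicolinear (regular_bicomodule D) (bicomodule_along psi) chi /\
      chi ∘ psi = idm C in
  let cond_ii :=
    mono psi /\
    exists chi : hom D C,
      bicolinear (regular_bicomodule D) (bicomodule_along psi) chi /\
      counit C ∘ chi ∘ psi = counit C in
  let cond_iii := naturally_full (coinduction Eq flatA psi) in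
  (cond_i <-> cond_ii) /\
  (cond_i \/ cond_ii -> cond_iii) /\
  (left_tensor_cogenerator (munit A) ->
     (cond_iii <-> cond_i) /\ (cond_iii <-> cond_ii)).
Proof.
move=> cond_i cond_ii cond_iii.
have i_ii : cond_i <-> cond_ii.
{ split; [move=> [chi [chi_lin chiK]] | move=> [psi_mono [chi [chi_lin chiE]]]].
  - split; last by exists chi; split=> //; rewrite -compA chiK compm1.
    by move=> W g h E; rewrite -(comp1m g) -(comp1m h) -chiK -!compA E.
  - exists chi; split=> //; apply: psi_mono; rewrite compA compm1.
    exact: bicolinear_counit_retraction. }
have i_iii : cond_i -> cond_iii.
  case=> chi [chi_lin chiK].
  rewrite /cond_iii; apply: retraction_naturally_full.
  exact: chi_section_retraction chiK.
have iii_i : left_tensor_cogenerator (munit A) -> cond_iii -> cond_i.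
  move=> cogen /naturally_full_retraction [s sP].
  exact: retraction_bicolinear sP cogen.
tauto.
Qed.
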